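(* Let $\varepsilon>1$, $\gamma\in(0,1]$, $C>0$, $C^b>0$. Suppose customers care about fairness (the fairness function $F$ on $[0,M^h]$ is as in the context) and infer costs subproportionally, i.e. the perceived marginal cost at price $P$ is $$C^p(P)=(C^b)^{\gamma}\left(\frac{\varepsilon-1}{\varepsilon}P\right)^{1-\gamma},$$ and the perceived markup is $M^p(P)=P/C^p(P)$. Assume that the perceived markup is below $M^h$ when the firm prices at marginal cost: $M^p(C)<M^h$. Then the monopoly's profit-maximizing markup $M=P/C$ is implicitly defined by (i.e. is the unique solution of) $$M=1+\frac{1}{\varepsilon-1}\cdot\frac{1}{1+\gamma\,\phi\big(M^p(M\cdot C)\big)},$$ which implies that $M\in\left(1,\frac{\varepsilon}{\varepsilon-1}\right)$. Furthermore, the cost passthrough $\beta=\frac{d\ln P}{d\ln C}$ (with $C^b$ held fixed) is given by $$\beta=\frac{1}{1+\dfrac{\gamma^{2}\phi\,\sigma}{(1+\gamma\phi)\,[\varepsilon+(\varepsilon-1)\gamma\phi]}},$$ where $\phi$ and $\sigma$ are evaluated at $M^p(M\cdot C)$; this implies $\beta\in(0,1)$. Hence the markup is strictly lower than its value $\varepsilon/(\varepsilon-1)$ without fairness concerns or with rational inference, and, unlike in those two cases (where $\beta=1$), the cost passthrough is incomplete.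
   Context: Monopoly model. A monopoly with constant marginal cost $C>0$ sells a good at a single price $P$ to a representative customer, who does not observe $C$ but perceives a marginal cost $C^p(P)$ and hence a markup $M^p(P)=P/C^p(P)$. The customer chooses $Y$ to maximize $\frac{\varepsilon}{\varepsilon-1}(F\cdot Y)^{(\varepsilon-1)/\varepsilon}+W-P\cdot Y$, where $W>0$ is wealth, $\varepsilon>1$, and $F=F(M^p(P))$ is taken as given; this gives the demand curve $Y^d(P)=P^{-\varepsilon}F(M^p(P))^{\varepsilon-1}$. The monopoly chooses $P$ to maximize $(P-C)\,Y^d(P)$ over prices $P>C$ with $M^p(P)<M^h$. Customers care about fairness: $F$ is twice differentiable and strictly decreasing and weakly concave on $[0,M^h]$, with $F>0$ on $[0,M^h)$, $F(M^h)=0$ and $M^h>\varepsilon/(\varepsilon-1)$. Its elasticity is $\phi(M^p)=-\frac{d\ln F}{d\ln M^p}=-M^pF'(M^p)/F(M^p)$ and its superelasticity is $\sigma(M^p)=\frac{d\ln\phi}{d\ln M^p}=M^p\phi'(M^p)/\phi(M^p)$. Benchmarks: without fairness concerns ($F\equiv1$), and in the separating equilibrium with rational inference of costs, the markup is $\varepsilon/(\varepsilon-1)$ and the passthrough is $1$. *)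

(* Defs.v *)
(* Concrete reals of the standard library, with Coquelicot for derivatives. *)
From Stdlib Require Import Reals Lra.
From Coquelicot Require Import Coquelicot.
Open Scope R_scope.

(* d ln f / d ln x : derivative at ln x of t |-> ln (f (exp t)). *)
Definition is_elasticity (f : R -> R) (x e : R) : Prop :=
  is_derive (fun t => ln (f (exp t))) (ln x) e.

Definition elasticity (f : R -> R) (x : R) : R :=
  Derive (fun t => ln (f (exp t))) (ln x).

Lemma is_elasticity_derive (f : R -> R) (x l : R) :
  0 < x -> 0 < f x -> is_derive f x l -> is_elasticity f x (x * l / f x).
Proof.
intros hx hf hd; unfold is_elasticity.
assert (he : exp (ln x) = x) by now apply exp_ln.
replace (x * l / f x) with ((x * l) * / f x) by reflexivity.
apply (is_derive_comp ln (fun t => f (exp t)) (ln x) (/ f x) (x * l)).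
- rewrite he; now apply is_derive_Reals, derivable_pt_lim_ln.
- apply (is_derive_comp f exp (ln x) l x).
  + now rewrite he.
  + rewrite <- he at 2; apply is_derive_exp.
Qed.

Lemma elasticityE (f : R -> R) (x : R) :
  0 < x -> 0 < f x -> ex_derive f x -> elasticity f x = x * Derive f x / f x.
Proof.
intros hx hf hd.
apply is_derive_unique, is_elasticity_derive; trivial.
now apply Derive_correct.
Qed.

(* Derivatives on the closed interval are relative to it, hence one-sided at
   the endpoints; the values of F outside [0, Mh] are irrelevant. *)
Record fairness_function (eps Mh : R) (F : R -> R) : Prop := {
  fairness_diff2 : exists F1 F2 : R -> R, forall x, 0 <= x <= Mh ->
    D_in F F1 (fun y => 0 <= y <= Mh) x /\ D_in F1 F2 (fun y => 0 <= y <= Mh) x;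
  fairness_decr : forall x y, 0 <= x -> x < y -> y <= Mh -> F y < F x;
  fairness_concave : forall x y t,
    0 <= x <= Mh -> 0 <= y <= Mh -> 0 <= t <= 1 ->
    t * F x + (1 - t) * F y <= F (t * x + (1 - t) * y);
  fairness_pos : forall x, 0 <= x < Mh -> 0 < F x;
  fairness_Mh : F Mh = 0;
  fairness_bound : eps / (eps - 1) < Mh
}.

Definition fairness_elasticity (F : R -> R) (m : R) : R := - elasticity F m.

Definition fairness_superelasticity (F : R -> R) (m : R) : R := elasticity (fairness_elasticity F) m.

Definition perceived_markup (Cp : R -> R) (P : R) : R := P / Cp P.

Definition subproportional_cost (eps gamma Cb P : R) : R :=
  Rpower Cb gamma * Rpower ((eps - 1) / eps * P) (1 - gamma).

Definition utility (eps W f P Y : R) : R :=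
  eps / (eps - 1) * Rpower (f * Y) ((eps - 1) / eps) + W - P * Y.

Definition demand (eps : R) (F Cp : R -> R) (P : R) : R :=
  Rpower P (- eps) * Rpower (F (perceived_markup Cp P)) (eps - 1).

Lemma Rpower_tangent (a t : R) :
  0 <= a <= 1 -> 0 < t -> Rpower t a <= 1 + a * (t - 1).
Proof.
intros ha ht; unfold Rpower.
set (L := ln t); set (s := a * L).
assert (hs := exp_pos s).
assert (h1 := exp_ineq1_le (L - s)); assert (h2 := exp_ineq1_le (- s)).
assert (e1 : exp (L - s) * exp s = t).
{ rewrite <- exp_plus; replace (L - s + s) with L by ring; now apply exp_ln. }
assert (e2 : exp (- s) * exp s = 1).
{ rewrite <- exp_plus; replace (- s + s) with 0 by ring; apply exp_0. }
assert (k : 1 <= a * exp (L - s) + (1 - a) * exp (- s)).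
{ assert (a * (1 + (L - s)) <= a * exp (L - s)) by (apply Rmult_le_compat_l; lra).
  assert ((1 - a) * (1 + - s) <= (1 - a) * exp (- s))
    by (apply Rmult_le_compat_l; lra).
  unfold s in *; lra. }
apply (Rmult_le_compat_r (exp s)) in k; [|lra].
replace ((a * exp (L - s) + (1 - a) * exp (- s)) * exp s)
  with (a * (exp (L - s) * exp s) + (1 - a) * (exp (- s) * exp s)) in k by ring.
rewrite e1, e2 in k; lra.
Qed.

Lemma demand_utility_max (eps W P Y : R) (F Cp : R -> R) :
  1 < eps -> 0 < P -> 0 < F (perceived_markup Cp P) -> 0 < Y ->
  utility eps W (F (perceived_markup Cp P)) P Y
  <= utility eps W (F (perceived_markup Cp P)) P (demand eps F Cp P).
Proof.
intros heps hP; unfold demand.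
set (f := F _); intros hf hY; unfold utility.
set (a := (eps - 1) / eps); set (y := Rpower P (- eps) * Rpower f (eps - 1)).
assert (hy : 0 < y) by (apply Rmult_lt_0_compat; apply exp_pos).
assert (ha : 0 <= a <= 1).
{ unfold a; split.
  - apply Rlt_le, Rdiv_lt_0_compat; lra.
  - apply (Rmult_le_reg_r eps); [lra|]; field_simplify; lra. }
assert (foc : Rpower (f * y) a = P * y).
{ unfold y, Rpower; rewrite <- exp_plus.
  rewrite <- (exp_ln f hf) at 1; rewrite <- exp_plus, ln_exp.
  rewrite <- (exp_ln P hP) at 2; rewrite <- exp_plus.
  f_equal; unfold a; field; lra. }
assert (ht : 0 < Y / y) by now apply Rdiv_lt_0_compat.
assert (hfy : 0 < f * y) by now apply Rmult_lt_0_compat.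
replace (f * Y) with (f * y * (Y / y)) by (field; lra).
rewrite <- Rpower_mult_distr by trivial.
assert (k := Rpower_tangent a (Y / y) ha ht).
assert (hPy : 0 < P * y) by now apply Rmult_lt_0_compat.
rewrite foc.
apply (Rmult_le_compat_l (P * y)) in k; [|lra].
apply (Rmult_le_compat_l (eps / (eps - 1))) in k;
  [|apply Rlt_le, Rdiv_lt_0_compat; lra].
replace (eps / (eps - 1) * (P * y * (1 + a * (Y / y - 1))))
  with (eps / (eps - 1) * (P * y) + P * Y - P * y) in k
  by (unfold a; field; lra).
lra.
Qed.

Definition profit (C : R) (Yd : R -> R) (P : R) : R := (P - C) * Yd P.

Definition is_maximizer (A : R -> Prop) (f : R -> R) (x : R) : Prop :=
  A x /\ forall y, A y -> f y <= f x.

Definition optimal_price (eps Mh : R) (F Cp : R -> R) (C P : R) : Prop :=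
  is_maximizer (fun p => C < p /\ perceived_markup Cp p < Mh)
    (profit C (demand eps F Cp)) P.

(* With F = 1 the demand does not depend on Cp and there is no cutoff Mh. *)
Definition optimal_price_no_fairness (eps : R) (Cp : R -> R) (C P : R) : Prop :=
  is_maximizer (fun p => C < p) (profit C (demand eps (fun _ => 1) Cp)) P.

(* A pricing strategy that is optimal for every cost given the beliefs Cp, which
   in turn recover the cost from the price (so that price is injective). *)
Definition separating_equilibrium
    (eps Mh : R) (F price Cp : R -> R) : Prop :=
  forall c, 0 < c -> optimal_price eps Mh F Cp c (price c) /\ Cp (price c) = c.

Definition proportional_price (eps c : R) : R := eps / (eps - 1) * c.

Definition proportional_cost (eps P : R) : R := (eps - 1) / eps * P.

(* Main.v *)
Require Import Defs.
From Stdlib Require Import Reals Lra ClassicalEpsilon.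
From Coquelicot Require Import Coquelicot.
Open Scope R_scope.

(* Concavity makes phi positive, strictly increasing and unbounded near Mh, with
   sigma > 0. The perceived markup is a constant times P^gamma, so demand has
   price elasticity d(P) = eps + (eps - 1) gamma phi(Mp P), which is increasing.
   Marginal profit at P has the sign of C - c(P), where c(P) = P (1 - 1 / d(P))
   is a strictly increasing bijection from the admissible prices onto the
   admissible costs. Hence the optimal price is the inverse function of c,
   c(P) = C is the markup formula, and the passthrough is the inverse of the
   elasticity of c. *)

(** * Calculus on the line: powers, one-sided information, concavity, inverse functions *)

Lemma Rpower_pos (x a : R) : 0 < Rpower x a.
Proof. apply exp_pos. Qed.

Lemma locally_interval (a b x : R) :
  a < x < b -> locally x (fun y => a < y < b).
Proof.
intros hx; apply (open_and _ _ (open_gt a) (open_lt b)); exact hx.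
Qed.

Lemma is_derive_power (x a : R) :
  0 < x -> is_derive (fun y => Rpower y a) x (a * Rpower x a / x).
Proof.
intros hx.
replace (a * Rpower x a / x) with (a * Rpower x (a - 1)).
- now apply is_derive_Reals, derivable_pt_lim_power.
- unfold Rminus, Rdiv; rewrite Rpower_plus, (Rpower_Ropp x 1), Rpower_1; trivial.
  ring.
Qed.

Lemma increasing_of_derive (f f' : R -> R) (a b : R) :
  a < b -> (forall x, a <= x <= b -> is_derive f x (f' x)) ->
  (forall x, a < x < b -> 0 < f' x) -> f a < f b.
Proof.
intros hab hd hpos.
destruct (MVT_cor2 f f' a b hab) as [z [hz1 hz2]].
- intros z hz; now apply is_derive_Reals, hd.
- assert (0 < f' z * (b - a)) by (apply Rmult_lt_0_compat; [now apply hpos | lra]).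
  lra.
Qed.

(** At an interior point, increments shorter than the distance to both endpoints stay in the
    interval, so the relative limit is an ordinary one. *)
Lemma is_derive_interior (f f1 : R -> R) (a b x : R) :
  a < x < b -> D_in f f1 (fun y => a <= y <= b) x -> is_derive f x (f1 x).
Proof.
intros hx hD; apply is_derive_Reals; intros e he.
destruct (hD e he) as [d [hd hlim]].
assert (hd' : 0 < Rmin d (Rmin (x - a) (b - x))).
{ repeat apply Rmin_glb_lt; lra. }
exists (mkposreal _ hd'); simpl; intros h hh hlt.
assert (k1 := Rmin_l d (Rmin (x - a) (b - x))).
assert (k2 := Rmin_r d (Rmin (x - a) (b - x))).
assert (k3 := Rmin_l (x - a) (b - x)).
assert (k4 := Rmin_r (x - a) (b - x)).
assert (hab : a <= x + h <= b) by (split_Rabs; lra).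
specialize (hlim (x + h)); simpl in hlim; unfold Rdist in hlim.
replace (x + h - x) with h in hlim by ring.
apply hlim; split; [split; [exact hab | lra] | lra].
Qed.

(** Along the segment from [x] to [y], concavity keeps every difference quotient at or above
    [f y - f x], hence also their limit [(y - x) * l]. Parametrizing by [t] treats both sides of [x]
    at once and lets [y] be an endpoint of the domain. *)
Lemma concave_tangent (f : R -> R) (l x y : R) :
  (forall t, 0 <= t <= 1 -> t * f y + (1 - t) * f x <= f (t * y + (1 - t) * x)) ->
  is_derive f x l -> f y - f x <= l * (y - x).
Proof.
intros hc hd.
assert (hg : is_derive (fun t => f (t * y + (1 - t) * x)) 0 ((y - x) * l)).
{ apply (is_derive_comp f (fun t => t * y + (1 - t) * x)).
  - now replace (0 * y + (1 - 0) * x) with x by ring.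
  - auto_derive; [trivial | ring]. }
apply Rnot_lt_le; intros hlt.
apply is_derive_Reals in hg.
destruct (hg (f y - f x - l * (y - x))) as [d hd0]; [lra|].
assert (hp := cond_pos d).
(* Small enough for the limit estimate, whose tolerance is the assumed excess over the tangent, and
   at most 1 for concavity. *)
set (t := Rmin (d / 2) 1).
assert (ht : 0 < t) by (apply Rmin_glb_lt; lra).
assert (ht1 : t <= 1) by apply Rmin_r.
assert (htd : t <= d / 2) by apply Rmin_l.
specialize (hd0 t); rewrite Rplus_0_l in hd0.
replace (0 * y + (1 - 0) * x) with x in hd0 by ring.
assert (ha : Rabs ((f (t * y + (1 - t) * x) - f x) / t - (y - x) * l)
             < f y - f x - l * (y - x)).
{ apply hd0; [lra | rewrite Rabs_pos_eq; lra]. }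
assert (hq : f y - f x <= (f (t * y + (1 - t) * x) - f x) / t).
{ apply (Rmult_le_reg_r t); [exact ht|].
  specialize (hc t); field_simplify; lra. }
apply Rabs_def2 in ha; lra.
Qed.

(** [g] is only known as a left inverse on [[a, b]]; the intermediate value theorem makes [f] onto
    [[f a, f b]], so there [g] is also a right inverse. *)
Lemma is_derive_inverse (f g : R -> R) (a b x l : R) :
  a < x < b -> (forall u v, a <= u -> u < v -> v <= b -> f u < f v) ->
  (forall u, a <= u <= b -> ex_derive f u) ->
  (forall u, a <= u <= b -> g (f u) = u) ->
  is_derive f x l -> l <> 0 -> is_derive g (f x) (/ l).
Proof.
intros hx hincr hder hgf hl hl0.
assert (hcont : forall u, a <= u <= b -> continuity_pt f u).
{ intros u hu; now apply derivable_continuous_pt, ex_derive_Reals_0, hder. }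
assert (hab : a < b) by lra.
assert (hfab : f a < f b) by (apply hincr; lra).
assert (hfx : f a < f x < f b) by (split; apply hincr; lra).
assert (Prf : forall u, g (f a) <= u <= g (f b) -> derivable_pt f u).
{ intros u; rewrite 2!hgf by lra; intros hu; now apply ex_derive_Reals_0, hder. }
assert (hgr : g (f a) <= g (f x) <= g (f b)) by (rewrite 3!hgf; lra).
assert (hl' : derive_pt f (g (f x)) (Prf (g (f x)) hgr) = l).
{ apply derive_pt_eq_0; rewrite hgf by lra; now apply is_derive_Reals. }
apply is_derive_Reals; replace (/ l) with (1 / l) by (field; trivial).
rewrite <- hl' at 1.
apply Ranalysis5.derivable_pt_lim_recip_interv; trivial.
- apply (Ranalysis5.continuity_pt_recip_prelim f g a b); trivial.
- intros y hy; unfold comp, id.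
  destruct (Ranalysis5.f_interv_is_interv f a b y hab hy hcont) as [u [hu <-]].
  now rewrite hgf.
- now rewrite hl'.
Qed.

Lemma derive_nonpos (f : R -> R) (a b x l : R) :
  a < x < b -> (forall y, x < y < b -> f y <= f x) -> is_derive f x l -> l <= 0.
Proof.
intros hx hf hd; apply Rnot_lt_le; intros hl.
apply is_derive_Reals in hd; destruct (hd l hl) as [d hlim].
assert (hp := cond_pos d).
set (t := Rmin (d / 2) ((b - x) / 2)).
assert (ht : 0 < t) by (apply Rmin_glb_lt; lra).
assert (htd : t <= d / 2) by apply Rmin_l.
assert (htb : t <= (b - x) / 2) by apply Rmin_r.
assert (ha : Rabs ((f (x + t) - f x) / t - l) < l).
{ apply hlim; [lra | rewrite Rabs_pos_eq; lra]. }
assert (hq : (f (x + t) - f x) / t <= 0).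
{ apply (Rmult_le_reg_r t); [exact ht|].
  assert (f (x + t) <= f x) by (apply hf; lra).
  field_simplify; lra. }
apply Rabs_def2 in ha; lra.
Qed.

(** * Elasticity and superelasticity of the fairness function *)

(** Everything comes from tangent lines lying above [F]. Adding the tangent inequalities at two
    points shows that [F1] decreases, whence [F2 <= 0]. Strict decrease of [F] alone gives only
    [F1 <= 0]; the tangent at [m] read at 0, with [F m < F 0], makes it strict. *)
Lemma fairness_derivatives (eps Mh : R) (F : R -> R) :
  fairness_function eps Mh F ->
  exists F1 F2 : R -> R,
    (forall m, 0 < m < Mh ->
      is_derive F m (F1 m) /\ is_derive F1 m (F2 m) /\ F1 m < 0 /\ F2 m <= 0 /\
      fairness_elasticity F m = - (m * F1 m / F m)) /\
    (forall m, 0 < m < Mh -> F m - F 0 >= m * F1 m) /\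
    (forall x y, 0 < x -> x < y -> y < Mh -> F1 y <= F1 x).
Proof.
intros hF; destruct (fairness_diff2 _ _ _ hF) as [F1 [F2 hD]].
assert (hd : forall m, 0 < m < Mh -> is_derive F m (F1 m)).
{ intros m hm; apply (is_derive_interior _ _ 0 Mh); trivial; apply hD; lra. }
assert (htan : forall x y, 0 < x < Mh -> 0 <= y <= Mh ->
  F y - F x <= F1 x * (y - x)).
{ intros x y hx hy; apply concave_tangent; [|now apply hd].
  intros t ht; apply (fairness_concave _ _ _ hF); lra. }
assert (hmono : forall x y, 0 < x -> x < y -> y < Mh -> F1 y <= F1 x).
{ intros x y hx hxy hy.
  assert (h1 := htan x y); assert (h2 := htan y x).
  apply (Rmult_le_reg_r (y - x)); lra. }
exists F1, F2; split; [|split; trivial].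
- intros m hm; split; [now apply hd|].
  assert (hd2 : is_derive F1 m (F2 m)).
  { apply (is_derive_interior _ _ 0 Mh); trivial; apply hD; lra. }
  split; [exact hd2|]; split; [|split].
  + assert (h1 := htan m 0); assert (h2 := fairness_decr _ _ _ hF 0 m).
    apply (Rmult_lt_reg_r m); lra.
  + apply (derive_nonpos F1 0 Mh m); trivial.
    intros y hy; apply hmono; lra.
  + unfold fairness_elasticity; rewrite elasticityE.
    * now rewrite (is_derive_unique _ _ _ (hd m hm)).
    * lra.
    * apply (fairness_pos _ _ _ hF); lra.
    * exists (F1 m); now apply hd.
- intros m hm; assert (h := htan m 0); lra.
Qed.

Lemma is_derive_fairness (eps Mh : R) (F : R -> R) (m : R) :
  fairness_function eps Mh F -> 0 < m < Mh ->
  is_derive F m (- (fairness_elasticity F m * F m / m)).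
Proof.
intros hF hm; destruct (fairness_derivatives _ _ _ hF) as [F1 [F2 [h _]]].
destruct (h m hm) as [hd [_ [_ [_ ->]]]].
assert (hp := fairness_pos _ _ _ hF m).
replace (- (_ * _ / _)) with (F1 m); trivial.
field; lra.
Qed.

Lemma fairness_elasticity_pos (eps Mh : R) (F : R -> R) (m : R) :
  fairness_function eps Mh F -> 0 < m < Mh -> 0 < fairness_elasticity F m.
Proof.
intros hF hm; destruct (fairness_derivatives _ _ _ hF) as [F1 [F2 [h _]]].
destruct (h m hm) as [_ [_ [hn [_ ->]]]].
assert (hp := fairness_pos _ _ _ hF m).
replace (- (m * F1 m / F m)) with (m * (- F1 m) / F m) by (field; lra).
apply Rdiv_lt_0_compat; [apply Rmult_lt_0_compat|]; lra.
Qed.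

(** In [m * (- F1 m) * / F m] the first and last factors strictly increase, and [- F1] weakly
    increases by concavity. *)
Lemma fairness_elasticity_incr (eps Mh : R) (F : R -> R) (x y : R) :
  fairness_function eps Mh F -> 0 < x -> x < y -> y < Mh ->
  fairness_elasticity F x < fairness_elasticity F y.
Proof.
intros hF hx hxy hy.
destruct (fairness_derivatives _ _ _ hF) as [F1 [F2 [h [_ hmono]]]].
destruct (h x) as [_ [_ [nx [_ ->]]]]; [lra|].
destruct (h y) as [_ [_ [ny [_ ->]]]]; [lra|].
assert (px := fairness_pos _ _ _ hF x); assert (py := fairness_pos _ _ _ hF y).
assert (hd := fairness_decr _ _ _ hF x y).
assert (hm := hmono x y).
replace (- (x * F1 x / F x)) with (x * (- F1 x) * / F x) by (field; lra).
replace (- (y * F1 y / F y)) with (y * (- F1 y) * / F y) by (field; lra).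
apply Rmult_le_0_lt_compat.
- apply Rmult_le_pos; lra.
- apply Rlt_le, Rinv_0_lt_compat; lra.
- apply Rlt_le_trans with (y * (- F1 x)).
  + apply Rmult_lt_compat_r; lra.
  + apply Rmult_le_compat_l; lra.
- apply Rinv_lt_contravar; [apply Rmult_lt_0_compat|]; lra.
Qed.

(* The tangent line at m lies above F at 0, so phi(m) >= F(0)/F(m) - 1. *)
Lemma fairness_elasticity_unbounded (eps Mh : R) (F : R -> R) (B m0 : R) :
  fairness_function eps Mh F -> 0 < m0 < Mh ->
  exists m, m0 < m < Mh /\ B < fairness_elasticity F m.
Proof.
intros hF hm0.
destruct (fairness_derivatives _ _ _ hF) as [F1 [F2 [h [htan _]]]].
destruct (fairness_diff2 _ _ _ hF) as [G1 [G2 hD]].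
assert (hc : continue_in F (fun y => 0 <= y <= Mh) Mh).
{ apply (cont_deriv F G1), hD; lra. }
assert (hF0 : 0 < F 0) by (apply (fairness_pos _ _ _ hF); lra).
(* [F m < e] amounts to [F 0 / F m - 1 > Rmax B 0], which the tangent bound carries over to the
   elasticity; [Rmax] keeps the denominator positive. *)
set (e := F 0 / (Rmax B 0 + 1)).
assert (hB := Rmax_r B 0); assert (hB' := Rmax_l B 0).
destruct (hc e) as [d [hd hlim]].
{ apply Rdiv_lt_0_compat; lra. }
(* Above [m0], and close enough to [Mh] from the left for continuity relative to [[0, Mh]] to apply,
   where [F Mh = 0]. *)
set (m := Rmax ((m0 + Mh) / 2) (Mh - d / 2)).
assert (h1 := Rmax_l ((m0 + Mh) / 2) (Mh - d / 2)).
assert (h2 := Rmax_r ((m0 + Mh) / 2) (Mh - d / 2)).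
assert (h3 : m < Mh) by (apply Rmax_lub_lt; lra).
fold m in h1, h2.
specialize (hlim m); simpl in hlim; unfold Rdist in hlim.
rewrite (fairness_Mh _ _ _ hF), Rminus_0_r in hlim.
assert (hm : 0 < m < Mh) by lra.
assert (hp : 0 < F m) by (apply (fairness_pos _ _ _ hF); lra).
assert (hFm : F m < e).
{ rewrite <- (Rabs_pos_eq (F m)) by lra; apply hlim; split; [repeat split; lra|].
  rewrite Rabs_left; lra. }
exists m; split; [lra|].
destruct (h m hm) as [_ [_ [_ [_ ->]]]].
apply (Rmult_lt_reg_r (F m)); [exact hp|].
replace (- (m * F1 m / F m) * F m) with (- (m * F1 m)) by (field; lra).
assert (ht := htan m hm).
assert (F m * (Rmax B 0 + 1) < F 0).
{ apply (Rmult_lt_compat_r (Rmax B 0 + 1)) in hFm; [|lra].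
  unfold e in hFm; field_simplify (F 0 / (Rmax B 0 + 1) * (Rmax B 0 + 1)) in hFm; lra. }
assert (B * F m <= Rmax B 0 * F m) by (apply Rmult_le_compat_r; lra).
lra.
Qed.

(** The derivative of the elasticity has numerator [- F1 F - m F2 F + m F1^2]: the outer terms are
    positive since [F1 < 0], the middle one is nonnegative since [F2 <= 0]. *)
Lemma fairness_superelasticity_spec (eps Mh : R) (F : R -> R) (m : R) :
  fairness_function eps Mh F -> 0 < m < Mh ->
  is_derive (fairness_elasticity F) m
    (fairness_elasticity F m * fairness_superelasticity F m / m) /\
  0 < fairness_superelasticity F m.
Proof.
intros hF hm.
assert (hphi := fairness_elasticity_pos _ _ _ m hF hm).
destruct (fairness_derivatives _ _ _ hF) as [F1 [F2 [h _]]].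
destruct (h m hm) as [hd [hd2 [hn [hn2 hE]]]].
assert (hp : 0 < F m) by (apply (fairness_pos _ _ _ hF); lra).
set (l := - (((1 * F1 m + m * F2 m) * F m - m * F1 m * F1 m) / F m ^ 2)).
assert (hl : is_derive (fairness_elasticity F) m l).
{ apply (is_derive_ext_loc (fun x => - (x * F1 x / F x))).
  - apply (filter_imp (fun x => 0 < x < Mh)); [|now apply locally_interval].
    intros x hx; now destruct (h x hx) as [_ [_ [_ [_ ->]]]].
  - apply (is_derive_opp (fun x => x * F1 x / F x)).
    apply (is_derive_div (fun x => x * F1 x) F); trivial; [|lra].
    apply (is_derive_mult (fun x => x) F1 m 1 (F2 m)); trivial.
    + exact (is_derive_id m).
    + exact Rmult_comm. }
assert (hs : fairness_superelasticity F m = m * l / fairness_elasticity F m).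
{ unfold fairness_superelasticity; rewrite elasticityE.
  - now rewrite (is_derive_unique _ _ _ hl).
  - lra.
  - exact hphi.
  - now exists l. }
split.
- rewrite hs; replace (_ * _ / m) with l; trivial; field; lra.
- rewrite hs; apply Rdiv_lt_0_compat; trivial.
  apply Rmult_lt_0_compat; [lra|].
  assert (0 < F1 m * F1 m) by (replace (F1 m * F1 m) with ((- F1 m) * (- F1 m)) by ring;
                              apply Rmult_lt_0_compat; lra).
  assert (0 <= m * (- F2 m) * F m) by (repeat apply Rmult_le_pos; lra).
  assert (0 < (- F1 m) * F m) by (apply Rmult_lt_0_compat; lra).
  assert (0 < m * (F1 m * F1 m)) by (apply Rmult_lt_0_compat; lra).
  unfold l; rewrite <- Rdiv_opp_l; apply Rdiv_lt_0_compat; [lra|].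
  apply pow_lt; lra.
Qed.

(** * Lerner costs and the maximization of profit *)

(* The marginal cost at which p satisfies the Lerner formula
   (p - c) / p = 1 / d p for a demand curve of price elasticity d. *)
Definition lerner_cost (d : R -> R) (p : R) : R := p - p / d p.

Lemma lerner_costE (d : R -> R) (p : R) :
  1 < d p -> lerner_cost d p = p * (1 - / d p).
Proof. intros hd; unfold lerner_cost; field; lra. Qed.

Lemma lerner_cost_bounds (d : R -> R) (p : R) :
  0 < p -> 1 < d p -> 0 < lerner_cost d p < p.
Proof.
intros hp hd; rewrite lerner_costE by trivial.
assert (0 < / d p) by (apply Rinv_0_lt_compat; lra).
assert (/ d p < 1) by (rewrite <- Rinv_1; apply Rinv_lt_contravar; lra).
split; [apply Rmult_lt_0_compat; lra|].
rewrite <- (Rmult_1_r p) at 3; apply Rmult_lt_compat_l; lra.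
Qed.

(** In [p * (1 - / d p)] the first factor strictly increases, so weak monotonicity of [d] suffices;
    this also covers constant elasticity. *)
Lemma lerner_cost_incr (d : R -> R) (x y : R) :
  0 < x -> x < y -> 1 < d x -> d x <= d y ->
  lerner_cost d x < lerner_cost d y.
Proof.
intros hx hxy hdx hdy; rewrite 2!lerner_costE by lra.
assert (/ d y <= / d x) by (apply Rinv_le_contravar; lra).
assert (/ d x < 1) by (rewrite <- Rinv_1; apply Rinv_lt_contravar; lra).
apply Rlt_le_trans with (y * (1 - / d x)).
- apply Rmult_lt_compat_r; lra.
- apply Rmult_le_compat_l; lra.
Qed.

(** With [e] the elasticity of [d], the elasticity of the Lerner cost is [1 + e / (d - 1)]. *)
Lemma is_derive_lerner_cost (d : R -> R) (p e : R) :
  0 < p -> 1 < d p -> is_derive d p (d p * e / p) ->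
  is_derive (lerner_cost d) p
    (lerner_cost d p / p * (1 + e / (d p - 1))).
Proof.
intros hp hd he; unfold lerner_cost.
replace (_ / p * _) with (1 - (1 * d p - p * (d p * e / p)) / d p ^ 2)
  by (field; lra).
apply (is_derive_minus (fun q => q) (fun q => q / d q)).
- exact (is_derive_id p).
- apply (is_derive_div (fun q => q)); trivial; [exact (is_derive_id p) | lra].
Qed.

(** Marginal profit factors as a positive weight times [c - lerner_cost d q]. It changes sign once,
    from plus to minus at [p0], so profit rises strictly before [p0] and falls strictly after; no
    concavity of profit is involved. *)
Lemma profit_maximizer (A : R -> Prop) (Yd d : R -> R) (c p0 p : R) :
  0 < c -> (forall q, A q -> c < q) ->
  (forall x y q, A x -> A y -> x <= q <= y -> A q) ->
  (forall q, A q -> 0 < Yd q /\ 1 < d q /\ is_derive Yd q (- (d q * Yd q / q))) ->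
  (forall x y, A x -> A y -> x < y -> lerner_cost d x < lerner_cost d y) ->
  A p0 -> lerner_cost d p0 = c ->
  is_maximizer A (profit c Yd) p <-> p = p0.
Proof.
intros hc hA hconv hYd hincr hp0 hcost.
set (w := fun q => Yd q * d q / q).
assert (hd : forall q, A q ->
  is_derive (profit c Yd) q (w q * (lerner_cost d p0 - lerner_cost d q))).
{ intros q hq; assert (hcq := hA q hq).
  destruct (hYd q hq) as [hY [hdq hder]]; rewrite hcost.
  replace (w q * _) with (1 * Yd q + (q - c) * - (d q * Yd q / q))
    by (unfold w, lerner_cost; field; lra).
  apply (is_derive_mult (fun q => q - c) Yd q 1).
  - auto_derive; trivial.
  - exact hder.
  - exact Rmult_comm. }
assert (hw : forall q, A q -> 0 < w q).
{ intros q hq; assert (hcq := hA q hq); destruct (hYd q hq) as [hY [hdq _]].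
  apply Rdiv_lt_0_compat; [apply Rmult_lt_0_compat|]; lra. }
assert (hmax : forall q, A q -> q <> p0 -> profit c Yd q < profit c Yd p0).
{ intros q hq hne; destruct (Rtotal_order q p0) as [hlt | [heq | hgt]].
  - apply (increasing_of_derive (profit c Yd)
      (fun x => w x * (lerner_cost d p0 - lerner_cost d x)) q p0 hlt).
    + intros x hx; apply hd, (hconv q p0); trivial.
    + intros x hx; assert (hAx : A x) by (apply (hconv q p0); trivial; lra).
      apply Rmult_lt_0_compat; [now apply hw|].
      assert (lerner_cost d x < lerner_cost d p0) by (apply hincr; trivial; lra).
      lra.
  - contradiction.
  - apply Ropp_lt_cancel.
    apply (increasing_of_derive (fun x => - profit c Yd x)
      (fun x => - (w x * (lerner_cost d p0 - lerner_cost d x))) p0 q hgt).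
    + intros x hx; apply (is_derive_opp (profit c Yd)), hd, (hconv p0 q); trivial.
    + intros x hx; assert (hAx : A x) by (apply (hconv p0 q); trivial; lra).
      rewrite Ropp_mult_distr_r; apply Rmult_lt_0_compat; [now apply hw|].
      assert (lerner_cost d p0 < lerner_cost d x) by (apply hincr; trivial; lra).
      lra. }
split.
- intros [hAp hp]; destruct (Req_dec p p0) as [heq | hne]; trivial.
  assert (h1 := hmax p hAp hne); assert (h2 := hp p0 hp0); lra.
- intros ->; split; trivial; intros q hq.
  destruct (Req_dec q p0) as [-> | hne]; [lra|].
  now apply Rlt_le, hmax.
Qed.

(** * Price elasticity of demand, and the benchmark of constant perception *)

(** Here [- e] is the price elasticity of the fairness factor. Demand inherits [- eps] from the
    power of the price and [- (eps - 1) * e] from the power of the fairness factor. *)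
Lemma is_derive_demand (eps e p : R) (F Cp : R -> R) :
  0 < p -> 0 < F (perceived_markup Cp p) ->
  is_derive (fun q => F (perceived_markup Cp q)) p
    (- (e * F (perceived_markup Cp p) / p)) ->
  is_derive (demand eps F Cp) p
    (- ((eps + (eps - 1) * e) * demand eps F Cp p / p)).
Proof.
intros hp hf hd; unfold demand; set (f := fun q => F (perceived_markup Cp q)) in *.
change (F (perceived_markup Cp p)) with (f p) in *.
replace (- (_ * _ / p)) with
  (- eps * Rpower p (- eps) / p * Rpower (f p) (eps - 1)
   + Rpower p (- eps) *
     (- (e * f p / p) * ((eps - 1) * Rpower (f p) (eps - 1) / f p)))
  by (field; lra).
apply (is_derive_mult (fun q => Rpower q (- eps)) (fun q => Rpower (f q) (eps - 1))).
- now apply is_derive_power.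
- apply (is_derive_comp (fun y => Rpower y (eps - 1)) f p); trivial.
  now apply is_derive_power.
- exact Rmult_comm.
Qed.

Lemma demand_pos (eps p : R) (F Cp : R -> R) : 0 < demand eps F Cp p.
Proof. apply Rmult_lt_0_compat; apply Rpower_pos. Qed.

(* When perception does not respond to the price, demand has constant price
   elasticity eps. *)
Lemma constant_perception_maximizer (eps c k p : R) (A : R -> Prop) (F Cp : R -> R) :
  1 < eps -> 0 < c -> 0 < k ->
  (forall q, 0 < q -> F (perceived_markup Cp q) = k) ->
  (forall q, A q <-> c < q) ->
  is_maximizer A (profit c (demand eps F Cp)) p <-> p = proportional_price eps c.
Proof.
intros heps hc hk hF hA.
assert (hcost : lerner_cost (fun _ => eps) (proportional_price eps c) = c).
{ unfold lerner_cost, proportional_price; field; lra. }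
apply (profit_maximizer _ _ (fun _ => eps)); trivial.
- intros q; apply hA.
- intros x y q hx hy hq; apply hA in hx; apply hA; lra.
- intros q hq; apply hA in hq; split; [apply demand_pos | split; trivial].
  replace eps with (eps + (eps - 1) * 0) at 2 by ring.
  apply is_derive_demand; [lra | rewrite hF; lra |].
  apply (is_derive_ext_loc (fun _ => k)).
  + apply (filter_imp (fun x => 0 < x < q + 1)); [|apply locally_interval; lra].
    intros x hx; rewrite hF; lra.
  + replace (- (_ / q)) with 0 by (field; lra).
    apply (is_derive_const k).
- intros x y hx hy hxy; apply hA in hx; apply lerner_cost_incr; lra.
- apply hA; rewrite <- hcost at 1; apply lerner_cost_bounds; trivial.
  apply Rmult_lt_0_compat; trivial; apply Rdiv_lt_0_compat; lra.
Qed.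

(** * Perceived markups proportional to a power of the price *)

(** The properties of [K * Rpower p gamma] that the argument uses; later lemmas treat the perceived
    markup through them alone. *)
Record isoelastic (gamma : R) (g : R -> R) : Prop := {
  isoelastic_pos : forall p, 0 < p -> 0 < g p;
  isoelastic_incr : forall p q, 0 < p -> p < q -> g p < g q;
  isoelastic_onto : forall m, 0 < m -> exists p, 0 < p /\ g p = m;
  isoelastic_derive : forall p, 0 < p -> is_derive g p (gamma * g p / p)
}.

Lemma isoelastic_power (K gamma : R) (g : R -> R) :
  0 < K -> 0 < gamma -> (forall p, 0 < p -> g p = K * Rpower p gamma) ->
  isoelastic gamma g.
Proof.
intros hK hgamma hg; split.
- intros p hp; rewrite hg by trivial; apply Rmult_lt_0_compat; trivial.
  apply Rpower_pos.
- intros p q hp hpq; rewrite 2!hg by lra.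
  apply Rmult_lt_compat_l; trivial; apply Rlt_Rpower_l; lra.
- intros m hm; exists (Rpower (m / K) (/ gamma)); split; [apply Rpower_pos|].
  rewrite hg by apply Rpower_pos.
  rewrite Rpower_mult, Rinv_l, Rpower_1 by (try lra; now apply Rdiv_lt_0_compat).
  field; lra.
- intros p hp; apply (is_derive_ext_loc (fun q => K * Rpower q gamma)).
  + apply (filter_imp (fun x => 0 < x < p + 1)); [|apply locally_interval; lra].
    intros x hx; rewrite hg; lra.
  + rewrite hg by trivial.
    replace (_ / p) with (K * (gamma * Rpower p gamma / p)) by (field; lra).
    now apply (is_derive_scal (fun q => Rpower q gamma)), is_derive_power.
Qed.

(** Splitting [p] as [Rpower p gamma * Rpower p (1 - gamma)] cancels the price-dependent part of the
    perceived cost. *)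
Lemma isoelastic_subproportional (eps gamma Cb : R) :
  1 < eps -> 0 < gamma ->
  isoelastic gamma (perceived_markup (subproportional_cost eps gamma Cb)).
Proof.
intros heps hgamma.
assert (ha : 0 < (eps - 1) / eps) by (apply Rdiv_lt_0_compat; lra).
apply (isoelastic_power
  (/ (Rpower Cb gamma * Rpower ((eps - 1) / eps) (1 - gamma)))); trivial.
- apply Rinv_0_lt_compat, Rmult_lt_0_compat; apply Rpower_pos.
- intros p hp; unfold perceived_markup, subproportional_cost.
  rewrite <- Rpower_mult_distr by trivial.
  assert (h1 := Rpower_pos Cb gamma).
  assert (h2 := Rpower_pos ((eps - 1) / eps) (1 - gamma)).
  assert (h3 := Rpower_pos p (1 - gamma)).
  assert (h : p = Rpower p gamma * Rpower p (1 - gamma)).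
  { rewrite <- Rpower_plus; replace (gamma + (1 - gamma)) with 1 by ring.
    now rewrite Rpower_1. }
  rewrite h at 1; field; lra.
Qed.

(** The price whose perceived markup is halfway between [g c] and [Mh] works; it exists because [g]
    is onto. *)
Lemma isoelastic_room (gamma Mh c : R) (g : R -> R) :
  isoelastic gamma g -> 0 < c -> g c < Mh -> exists p, c < p /\ g p < Mh.
Proof.
intros hg hc hlt; assert (hp := isoelastic_pos _ _ hg c hc).
destruct (isoelastic_onto _ _ hg ((g c + Mh) / 2)) as [p [hp0 hpe]]; [lra|].
exists p; split; [|lra].
apply Rnot_le_lt; intros hle; destruct (Rle_lt_or_eq_dec _ _ hle) as [h | ->]; [|lra].
assert (h' := isoelastic_incr _ _ hg p c hp0 h); lra.
Qed.

Lemma isoelastic_le (gamma p q : R) (g : R -> R) :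
  isoelastic gamma g -> 0 < p -> p <= q -> g p <= g q.
Proof.
intros hg hp hpq; destruct (Rle_lt_or_eq_dec _ _ hpq) as [h | ->]; [|lra].
now apply Rlt_le, (isoelastic_incr _ _ hg).
Qed.

(** * Lerner cost under fairness concerns: monotonicity, elasticity, range *)

(** The value of [eps + (eps - 1) * e] with [e = gamma * phi], which is minus the elasticity of [F]
    composed with [g] when [g] has elasticity [gamma]. *)
Definition demand_elasticity (eps gamma : R) (F g : R -> R) (p : R) : R :=
  eps + (eps - 1) * (gamma * fairness_elasticity F (g p)).

Lemma demand_elasticity_gt (eps gamma Mh p : R) (F g : R -> R) :
  1 < eps -> 0 < gamma -> fairness_function eps Mh F -> isoelastic gamma g ->
  0 < p -> g p < Mh -> eps < demand_elasticity eps gamma F g p.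
Proof.
intros heps hgamma hF hg hp hlt; unfold demand_elasticity.
assert (hphi : 0 < fairness_elasticity F (g p)).
{ apply (fairness_elasticity_pos _ _ _ _ hF).
  split; trivial; now apply (isoelastic_pos _ _ hg). }
assert (0 < (eps - 1) * (gamma * fairness_elasticity F (g p)));
  [repeat apply Rmult_lt_0_compat|]; lra.
Qed.

Lemma demand_elasticity_lerner_incr (eps gamma Mh x y : R) (F g : R -> R) :
  1 < eps -> 0 < gamma -> fairness_function eps Mh F -> isoelastic gamma g ->
  0 < x -> x < y -> g y < Mh ->
  lerner_cost (demand_elasticity eps gamma F g) x
  < lerner_cost (demand_elasticity eps gamma F g) y.
Proof.
intros heps hgamma hF hg hx hxy hlt.
assert (hgxy := isoelastic_incr _ _ hg x y hx hxy).
apply lerner_cost_incr; trivial.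
- apply Rlt_trans with eps; trivial.
  apply (demand_elasticity_gt eps gamma Mh); trivial; lra.
- unfold demand_elasticity; apply Rplus_le_compat_l.
  repeat (apply Rmult_le_compat_l; [lra|]).
  apply Rlt_le, (fairness_elasticity_incr _ _ _ _ _ hF); trivial.
  now apply (isoelastic_pos _ _ hg).
Qed.

(** The elasticity of [d] is [(eps - 1) * gamma^2 * phi * sigma / d], and
    [d - 1 = (eps - 1) * (1 + gamma * phi)], so [eps - 1] cancels in the quotient. The last factor
    is the reciprocal of the passthrough. *)
Lemma is_derive_demand_elasticity_lerner (eps gamma Mh p : R) (F g : R -> R) :
  1 < eps -> 0 < gamma -> fairness_function eps Mh F -> isoelastic gamma g ->
  0 < p -> g p < Mh ->
  let d := demand_elasticity eps gamma F g in
  let phi := fairness_elasticity F (g p) in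
  let sigma := fairness_superelasticity F (g p) in
  is_derive (lerner_cost d) p
    (lerner_cost d p / p *
      (1 + gamma ^ 2 * phi * sigma
           / ((1 + gamma * phi) * (eps + (eps - 1) * gamma * phi)))).
Proof.
intros heps hgamma hF hg hp hlt d phi sigma.
assert (hgp := isoelastic_pos _ _ hg p hp).
assert (hd : eps < d p) by now apply (demand_elasticity_gt eps gamma Mh).
assert (hphi : 0 < phi) by now apply (fairness_elasticity_pos _ _ _ _ hF).
assert (hgphi : 0 < gamma * phi) by now apply Rmult_lt_0_compat.
assert (hdp : d p = eps + (eps - 1) * (gamma * phi)) by reflexivity.
destruct (fairness_superelasticity_spec _ _ _ (g p) hF) as [hder _]; [lra|].
fold phi sigma in hder.
replace (gamma ^ 2 * phi * sigma / _)
  with ((eps - 1) * (gamma * (gamma * (phi * sigma))) / d p / (d p - 1)).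
2:{ replace (d p - 1) with ((eps - 1) * (1 + gamma * phi)) by (rewrite hdp; ring).
    replace (eps + (eps - 1) * gamma * phi) with (d p) by (rewrite hdp; ring).
    field; lra. }
apply is_derive_lerner_cost; [trivial | lra |].
unfold d at 1, demand_elasticity.
replace (d p * _ / p)
  with (0 + (eps - 1) * (gamma * (gamma * g p / p * (phi * sigma / g p))))
  by (field; lra).
apply (is_derive_plus (fun _ => eps)); [apply (is_derive_const eps)|].
apply (is_derive_scal (fun q => gamma * fairness_elasticity F (g q))).
apply (is_derive_scal (fun q => fairness_elasticity F (g q))).
apply (is_derive_comp (fairness_elasticity F) g); trivial.
now apply (isoelastic_derive _ _ hg).
Qed.

(** Intermediate values: at the price [c] the Lerner cost is below [c], and near the cutoff it
    exceeds [c] because the elasticity is unbounded there. *)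
Lemma lerner_cost_onto (eps gamma Mh c : R) (F g : R -> R) :
  1 < eps -> 0 < gamma -> fairness_function eps Mh F -> isoelastic gamma g ->
  0 < c -> g c < Mh ->
  exists p, 0 < p /\ g p < Mh /\
    lerner_cost (demand_elasticity eps gamma F g) p = c.
Proof.
intros heps hgamma hF hg hc hgc; set (d := demand_elasticity eps gamma F g).
destruct (isoelastic_room _ _ _ _ hg hc hgc) as [p1 [hcp1 hp1]].
assert (hgp1 : 0 < g p1) by (apply (isoelastic_pos _ _ hg); lra).
(* The threshold makes [d p2 > p1 / (p1 - c)], that is [p1 * (1 - / d p2) > c]; then [p2 > p1] only
   increases the left side. *)
destruct (fairness_elasticity_unbounded _ _ _
  (p1 / (p1 - c) / ((eps - 1) * gamma)) (g p1) hF) as [m [hm hB]]; [lra|].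
destruct (isoelastic_onto _ _ hg m) as [p2 [hp2 <-]]; [lra|].
assert (hp12 : p1 < p2).
{ apply Rnot_le_lt; intros hle.
  assert (h := isoelastic_le _ _ _ _ hg hp2 hle); lra. }
assert (hdp2 : p1 / (p1 - c) < d p2).
{ assert (0 < (eps - 1) * gamma) by (apply Rmult_lt_0_compat; lra).
  apply (Rmult_lt_compat_r ((eps - 1) * gamma)) in hB; trivial.
  replace (p1 / (p1 - c) / ((eps - 1) * gamma) * ((eps - 1) * gamma))
    with (p1 / (p1 - c)) in hB by (field; lra).
  unfold d, demand_elasticity; lra. }
assert (hd : forall p, 0 < p -> g p < Mh -> 1 < d p).
{ intros p hp hlt; apply Rlt_trans with eps; trivial.
  now apply (demand_elasticity_gt eps gamma Mh). }
destruct (Ranalysis5.IVT_interv (fun p => lerner_cost d p - c) c p2) as [p [hp hpe]].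
- intros a ha; apply derivable_continuous_pt, ex_derive_Reals_0.
  assert (hga : g a < Mh).
  { apply Rle_lt_trans with (g p2); [|lra]; apply (isoelastic_le gamma); trivial; lra. }
  apply @ex_derive_minus; [|apply ex_derive_const].
  eexists; apply (is_derive_demand_elasticity_lerner eps gamma Mh); trivial; lra.
- lra.
- assert (lerner_cost d c < c) by (apply lerner_cost_bounds; auto); lra.
- rewrite lerner_costE by (apply hd; lra).
  assert (hi : / d p2 < (p1 - c) / p1).
  { replace ((p1 - c) / p1) with (/ (p1 / (p1 - c))) by (field; lra).
    assert (0 < p1 / (p1 - c)) by (apply Rdiv_lt_0_compat; lra).
    apply Rinv_lt_contravar; trivial; apply Rmult_lt_0_compat; lra. }
  assert (hi1 : / d p2 < 1) by (rewrite <- Rinv_1; apply Rinv_lt_contravar;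
    assert (h := hd p2 hp2); lra).
  assert (p1 * (1 - / d p2) < p2 * (1 - / d p2)) by (apply Rmult_lt_compat_r; lra).
  assert (p1 * / d p2 < p1 * ((p1 - c) / p1)) by (apply Rmult_lt_compat_l; lra).
  replace (p1 * ((p1 - c) / p1)) with (p1 - c) in * by (field; lra).
  lra.
- exists p; split; [lra | split; [|lra]].
  apply Rle_lt_trans with (g p2); [|lra]; apply (isoelastic_le gamma); trivial; lra.
Qed.

Lemma markup_formula_lerner (eps gamma c m : R) (F g : R -> R) :
  1 < eps -> 0 < c -> 0 < gamma * fairness_elasticity F (g (m * c)) ->
  m = 1 + 1 / (eps - 1) * (1 / (1 + gamma * fairness_elasticity F (g (m * c)))) <->
  lerner_cost (demand_elasticity eps gamma F g) (m * c) = c.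
Proof.
intros heps hc; unfold lerner_cost, demand_elasticity.
set (x := gamma * _); intros hx.
assert (hu : 0 < (eps - 1) * (1 + x)) by (apply Rmult_lt_0_compat; lra).
replace (eps + (eps - 1) * x) with (1 + (eps - 1) * (1 + x)) by ring.
replace (1 / (eps - 1) * (1 / (1 + x))) with (/ ((eps - 1) * (1 + x))) by (field; lra).
set (u := (eps - 1) * (1 + x)) in *.
split; intros h.
- rewrite h; field; lra.
(* The elasticity equals [1 + u], so the Lerner cost at [m * c] is [m] times this factor, and both
   equations say [m = 1 + / u]. *)
- apply (Rmult_eq_reg_r (c * u / (1 + u))).
  + replace (m * (c * u / (1 + u))) with (m * c - m * c / (1 + u)) by (field; lra).
    rewrite h; field; lra.
  + apply Rgt_not_eq, Rdiv_lt_0_compat; [now apply Rmult_lt_0_compat | lra].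
Qed.

Lemma optimal_price_lerner (eps gamma Mh c p0 p : R) (F Cp : R -> R) :
  1 < eps -> 0 < gamma -> fairness_function eps Mh F ->
  isoelastic gamma (perceived_markup Cp) ->
  0 < c -> 0 < p0 -> perceived_markup Cp p0 < Mh ->
  lerner_cost (demand_elasticity eps gamma F (perceived_markup Cp)) p0 = c ->
  optimal_price eps Mh F Cp c p <-> p = p0.
Proof.
intros heps hgamma hF; set (g := perceived_markup Cp); intros hg hc hp0 hgp0 hcost.
set (d := demand_elasticity eps gamma F g) in *.
assert (hd : forall q, 0 < q -> g q < Mh -> 1 < d q).
{ intros q hq hlt; apply Rlt_trans with eps; trivial.
  now apply (demand_elasticity_gt eps gamma Mh). }
apply (profit_maximizer _ _ d); trivial.
- now intros q [h _].
- intros x y q [hx _] [_ hy] hq; split; [lra|].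
  apply Rle_lt_trans with (g y); trivial; apply (isoelastic_le gamma); trivial; lra.
- intros q [hq hgq]; fold g in hgq; assert (hq0 : 0 < q) by lra.
  assert (hgq0 := isoelastic_pos _ _ hg q hq0).
  assert (hf : 0 < F (g q)) by (apply (fairness_pos _ _ _ hF); lra).
  split; [apply demand_pos | split; [now apply hd|]].
  apply is_derive_demand; trivial; fold g.
  (* The chain rule form: the fairness factor has price elasticity [- gamma * phi]. *)
  replace (- _) with
    (gamma * g q / q * (- (fairness_elasticity F (g q) * F (g q) / g q)))
    by (field; lra).
  apply (is_derive_comp F g).
  + apply (is_derive_fairness eps Mh); trivial; lra.
  + now apply (isoelastic_derive _ _ hg).
- intros x y [hx _] [_ hy] hxy.
  apply (demand_elasticity_lerner_incr eps gamma Mh); trivial; lra.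
- split; trivial; rewrite <- hcost; apply lerner_cost_bounds; auto.
Qed.

Theorem proposition1 (eps gamma C Cb Mh : R) (F : R -> R)
  (heps : 1 < eps) (hgamma : 0 < gamma <= 1) (hC : 0 < C) (hCb : 0 < Cb)
  (hF : fairness_function eps Mh F) :
  let Cp := subproportional_cost eps gamma Cb in
  let Mp := perceived_markup Cp in
  Mp C < Mh ->
  (* the profit-maximizing price, as a function of marginal cost *)
  exists price : R -> R,
    (forall c p, 0 < c -> Mp c < Mh ->
      (optimal_price eps Mh F Cp c p <-> p = price c)) /\
    let M := price C / C in
    (forall m,
      (0 < m /\ Mp (m * C) < Mh /\
       m = 1 + 1 / (eps - 1) * (1 / (1 + gamma * fairness_elasticity F (Mp (m * C)))))
      <-> m = M) /\
    1 < M < eps / (eps - 1) /\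
    (exists beta : R,
      is_elasticity price C beta /\
      (let phi := fairness_elasticity F (Mp (M * C)) in
       let sigma := fairness_superelasticity F (Mp (M * C)) in
       beta = 1 / (1 + gamma ^ 2 * phi * sigma
                       / ((1 + gamma * phi) * (eps + (eps - 1) * gamma * phi)))) /\
      0 < beta < 1) /\
    (* benchmarks: no fairness concerns, and rational inference *)
    (forall Cp0 c p, 0 < c ->
      (optimal_price_no_fairness eps Cp0 c p <-> p = proportional_price eps c)) /\
    separating_equilibrium eps Mh F
      (proportional_price eps) (proportional_cost eps) /\
    M < proportional_price eps C / C /\
    proportional_price eps C / C = eps / (eps - 1) /\
    is_elasticity (proportional_price eps) C 1.
Proof.
intros Cp Mp hMpC.
assert (hg : isoelastic gamma Mp) by (apply isoelastic_subproportional; lra).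
destruct hgamma as [hgamma _].
set (d := demand_elasticity eps gamma F Mp).
set (sol := fun c p => 0 < p /\ Mp p < Mh /\ lerner_cost d p = c).
(* Where [sol c] has no solution the value is arbitrary; [inhabits 0] only certifies that the type
   is inhabited. *)
set (price := fun c => epsilon (inhabits 0) (sol c)).
assert (hprice : forall c, 0 < c -> Mp c < Mh -> sol c (price c)).
{ intros c hc hlt; apply epsilon_spec; now apply lerner_cost_onto. }
assert (huniq : forall c p q, sol c p -> sol c q -> p = q).
{ intros c p q [hp [hp1 hp2]] [hq [hq1 hq2]].
  destruct (Rtotal_order p q) as [h | [h | h]]; trivial; exfalso.
  - assert (k := demand_elasticity_lerner_incr eps gamma Mh p q F Mp
      heps hgamma hF hg hp h hq1).
    fold d in k; lra.
  - assert (k := demand_elasticity_lerner_incr eps gamma Mh q p F Mp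
      heps hgamma hF hg hq h hp1).
    fold d in k; lra. }
(* Inversion at every admissible price, not only at [P], is what differentiating [price]
   requires. *)
assert (hinv : forall p, 0 < p -> Mp p < Mh -> price (lerner_cost d p) = p).
{ intros p hp hlt; assert (hs : sol (lerner_cost d p) p) by (now repeat split).
  apply (huniq (lerner_cost d p)); trivial.
  apply epsilon_spec; now exists p. }
destruct (hprice C hC hMpC) as [hP [hMpP hPC]]; set (P := price C) in *.
assert (hd : eps < d P) by now apply (demand_elasticity_gt eps gamma Mh).
assert (hCP : C < P).
{ rewrite <- hPC; apply lerner_cost_bounds; trivial; lra. }
assert (hMpP0 := isoelastic_pos _ _ hg P hP).
exists price; split.
{ intros c p hc hlt; destruct (hprice c hc hlt) as [h1 [h2 h3]].
  now apply (optimal_price_lerner eps gamma). }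
fold P; intros M.
assert (hMC : M * C = P) by (unfold M; field; lra).
assert (hM : 1 < M < eps / (eps - 1)).
{ split.
  - apply (Rmult_lt_reg_r C); lra.
  (* Since [C = P * (1 - / d P)], the strict bound [eps < d P] gives [P * (1 - / eps) < C]. *)
  - apply (Rmult_lt_reg_r C); trivial; rewrite hMC, <- hPC.
    rewrite lerner_costE by lra.
    assert (/ d P < / eps) by (apply Rinv_lt_contravar; trivial;
      apply Rmult_lt_0_compat; lra).
    assert (0 < eps / (eps - 1) * P) by
      (apply Rmult_lt_0_compat; trivial; apply Rdiv_lt_0_compat; lra).
    apply Rle_lt_trans with (eps / (eps - 1) * P * (1 - / eps)).
    + right; field; lra.
    + rewrite <- Rmult_assoc; apply Rmult_lt_compat_l; lra. }
split; [|split; [exact hM | split; [|split; [|split]]]].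
- assert (hiff : forall m, 0 < m -> Mp (m * C) < Mh ->
    m = 1 + 1 / (eps - 1) * (1 / (1 + gamma * fairness_elasticity F (Mp (m * C)))) <->
    lerner_cost d (m * C) = C).
  { intros m hm hlt; apply markup_formula_lerner; trivial.
    apply Rmult_lt_0_compat; trivial.
    apply (fairness_elasticity_pos _ _ _ _ hF); split; trivial.
    apply (isoelastic_pos _ _ hg); now apply Rmult_lt_0_compat. }
  intros m; split.
  + intros [hm [hlt h]]; apply hiff in h; trivial.
    assert (hmP : m * C = P).
    { apply (huniq C); repeat split; trivial; now apply Rmult_lt_0_compat. }
    rewrite <- hMC in hmP; apply (Rmult_eq_reg_r C); lra.
  + intros ->; assert (hlt : Mp (M * C) < Mh) by now rewrite hMC.
    split; [lra | split; trivial].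
    apply hiff; trivial; [lra | now rewrite hMC].
- rewrite hMC.
  set (phi := fairness_elasticity F (Mp P)).
  set (sigma := fairness_superelasticity F (Mp P)); cbv zeta.
  set (T := gamma ^ 2 * phi * sigma / _).
  assert (hT : 0 < T).
  { assert (hphi : 0 < phi) by now apply (fairness_elasticity_pos _ _ _ _ hF).
    assert (hsigma : 0 < sigma) by now apply (fairness_superelasticity_spec eps Mh).
    assert (0 < gamma * phi) by now apply Rmult_lt_0_compat.
    assert (0 < (eps - 1) * gamma * phi) by (repeat apply Rmult_lt_0_compat; lra).
    apply Rdiv_lt_0_compat; repeat apply Rmult_lt_0_compat; lra. }
  assert (hder : is_derive price C (/ (C / P * (1 + T)))).
  { destruct (isoelastic_room _ _ _ _ hg hP hMpP) as [b [hPb hb]].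
    assert (hin : forall u, P / 2 <= u <= b -> 0 < u /\ Mp u < Mh).
    { intros u hu; split; [lra|].
      apply Rle_lt_trans with (Mp b); trivial; apply (isoelastic_le gamma); trivial; lra. }
    rewrite <- hPC at 1.
    apply (is_derive_inverse (lerner_cost d) price (P / 2) b P).
    - lra.
    - intros u v hu huv hv; destruct (hin v); [lra|].
      apply (demand_elasticity_lerner_incr eps gamma Mh); trivial; lra.
    - intros u hu; destruct (hin u hu); eexists.
      now apply (is_derive_demand_elasticity_lerner eps gamma Mh).
    - intros u hu; destruct (hin u hu); now apply hinv.
    - rewrite <- hPC.
      now apply (is_derive_demand_elasticity_lerner eps gamma Mh).
    - apply Rgt_not_eq, Rmult_lt_0_compat; [apply Rdiv_lt_0_compat|]; lra. }
  exists (1 / (1 + T)); split; [|split; [reflexivity|split]].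
  + replace (1 / (1 + T)) with (C * / (C / P * (1 + T)) / price C)
      by (fold P; field; lra).
    now apply is_elasticity_derive.
  + apply Rdiv_lt_0_compat; lra.
  + unfold Rdiv; rewrite Rmult_1_l, <- Rinv_1; apply Rinv_lt_contravar; lra.
- intros Cp0 c p hc.
  apply (constant_perception_maximizer eps c 1); trivial; [lra | reflexivity].
(* Under proportional beliefs every price signals the same markup, below [Mh] by [fairness_bound];
   the cutoff never binds and the fairness factor is constant. *)
- assert (hconst : forall p, 0 < p ->
    perceived_markup (proportional_cost eps) p = eps / (eps - 1)).
  { intros p hp; unfold perceived_markup, proportional_cost; field; lra. }
  assert (hbound := fairness_bound _ _ _ hF).
  intros c hc; split.
  + apply (constant_perception_maximizer eps c (F (eps / (eps - 1)))); trivial.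
    * apply (fairness_pos _ _ _ hF); split; trivial.
      apply Rlt_le, Rdiv_lt_0_compat; lra.
    * intros q hq; now rewrite hconst.
    * intros q; split; [now intros [h _]|].
      intros h; split; trivial; rewrite hconst; lra.
  + unfold proportional_cost, proportional_price; field; lra.
- assert (hprop : proportional_price eps C / C = eps / (eps - 1))
    by (unfold proportional_price; field; lra).
  rewrite hprop; split; [apply hM | split; trivial].
  assert (0 < eps / (eps - 1)) by (apply Rdiv_lt_0_compat; lra).
  replace 1 with (C * (eps / (eps - 1)) / proportional_price eps C)
    by (unfold proportional_price; field; lra).
  apply is_elasticity_derive; trivial.
  + now apply Rmult_lt_0_compat.
  + unfold proportional_price; auto_derive; [trivial | ring].
Qed.
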